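(* Let $\mathbf A$ be a finite idempotent simple algebra which has no subdirect, proper, irredundant subpowers. Then there exists a ternary term operation $t$ of $\mathbf A$ such that for all $a,b\in A$ with $(a,b)\notin\mu_{\mathbf A}$ we have $t(a,a,b)=t(a,b,a)=t(b,a,a)=a$.
   Context: A subpower of $\mathbf A$ is a subuniverse of $\mathbf A^n$ for some $n$. A relation $R\subseteq A^n$ is subdirect if every coordinate projection is onto $A$, proper if $R\neq A^n$, and irredundant if for no distinct coordinates $i,j$ is the projection onto $i,j$ the graph of a bijection. $\mathrm{Sg}_{\mathbf A}(a,b)$ denotes the subuniverse generated by $a,b$. The connected-by-subuniverses equivalence $\mu_{\mathbf A}$ is the smallest equivalence relation on $A$ containing all pairs $(a,b)$ with $\mathrm{Sg}_{\mathbf A}(a,b)\neq A$. *)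

(* Defs.v *)
From HB Require Import structures.
From mathcomp Require Import all_boot.

Set Implicit Arguments.
Unset Strict Implicit.
Unset Printing Implicit Defensive.

Record signature := Signature {
  symbol : Type;
  arity : symbol -> nat
}.

(* A finite algebra; the set of symbols need not be finite, and arities 0 are
   allowed. The carrier is not required to be nonempty. *)
Record finAlgebra (S : signature) := FinAlgebra {
  carrier :> finType;
  op : forall s : symbol S, {ffun 'I_(arity s) -> carrier} -> carrier
}.

Definition power (S : signature) (A : finAlgebra S) (n : nat) : finAlgebra S :=
  @FinAlgebra S {ffun 'I_n -> A}
    (fun s (x : {ffun 'I_(arity s) -> {ffun 'I_n -> A}}) =>
       [ffun i => op [ffun k => x k i]]).

Inductive term (S : signature) (n : nat) : Type :=
  | Var of 'I_n
  | App (s : symbol S) of ('I_(arity s) -> term S n).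

Fixpoint eval (S : signature) (A : finAlgebra S) (n : nat)
    (v : {ffun 'I_n -> A}) (t : term S n) : A :=
  match t with
  | Var i => v i
  | App s args => op [ffun k : 'I_(arity s) => eval v (args k)]
  end.

Definition term_operation (S : signature) (A : finAlgebra S) (n : nat)
    (f : {ffun 'I_n -> A} -> A) : Prop :=
  exists t : term S n, forall v, f v = eval v t.

Definition ternary_term_operation (S : signature) (A : finAlgebra S)
    (f : A -> A -> A -> A) : Prop :=
  term_operation (fun v : {ffun 'I_3 -> A} =>
    f (v (@Ordinal 3 0 isT)) (v (@Ordinal 3 1 isT)) (v (@Ordinal 3 2 isT))).

Definition idempotent_algebra (S : signature) (A : finAlgebra S) : Prop :=
  forall (s : symbol S) (a : A), op [ffun _ : 'I_(arity s) => a] = a.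

Definition equivalence (T : Type) (e : rel T) : Prop :=
  [/\ reflexive e, symmetric e & transitive e].

Definition congruence (S : signature) (A : finAlgebra S) (e : rel A) : Prop :=
  equivalence e /\
  forall (s : symbol S) (x y : {ffun 'I_(arity s) -> A}),
    (forall k, e (x k) (y k)) -> e (op x) (op y).

(* One-element algebras count as simple. *)
Definition simple_algebra (S : signature) (A : finAlgebra S) : Prop :=
  forall e : rel A, congruence e ->
    (forall a b, e a b = (a == b)) \/ (forall a b, e a b).

(* The empty set is a subuniverse when there is no nullary symbol. *)
Definition subuniverse (S : signature) (A : finAlgebra S) (B : {set A}) : Prop :=
  forall (s : symbol S) (x : {ffun 'I_(arity s) -> A}),
    (forall k, x k \in B) -> op x \in B.

Definition subpower (S : signature) (A : finAlgebra S) (n : nat)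
    (R : {set {ffun 'I_n -> A}}) : Prop :=
  subuniverse (A := power A n) R.

Definition subdirect (T : finType) (n : nat) (R : {set {ffun 'I_n -> T}}) : Prop :=
  forall i : 'I_n, [set r i | r : {ffun 'I_n -> T} in R] = [set: T].

Definition proper_relation (T : finType) (n : nat)
    (R : {set {ffun 'I_n -> T}}) : Prop :=
  R <> [set: {ffun 'I_n -> T}].

Definition proj2 (T : finType) (n : nat) (R : {set {ffun 'I_n -> T}})
    (i j : 'I_n) : {set T * T} :=
  [set (r i, r j) | r : {ffun 'I_n -> T} in R].

Definition bijection_graph (T : finType) (G : {set T * T}) : Prop :=
  exists2 f : T -> T, bijective f & G = [set (x, f x) | x : T].

Definition irredundant (T : finType) (n : nat)
    (R : {set {ffun 'I_n -> T}}) : Prop :=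
  forall i j : 'I_n, i != j -> ~ bijection_graph (proj2 R i j).

(* Exponents are positive: in A^0 the empty set would be subdirect, proper and
   irredundant for trivial reasons. *)
Definition no_subdirect_proper_irredundant_subpower
    (S : signature) (A : finAlgebra S) : Prop :=
  ~ exists n : nat, 0 < n /\
      exists R : {set {ffun 'I_n -> A}},
        [/\ subpower R, subdirect R, proper_relation R & irredundant R].

(* Membership in the least subuniverse containing X. *)
Definition Sg (S : signature) (A : finAlgebra S) (X : {set A}) (x : A) : Prop :=
  forall B : {set A}, subuniverse B -> X \subset B -> x \in B.

(* The least equivalence relation, as the intersection of all equivalence
   relations containing the given pairs. *)
Definition mu (S : signature) (A : finAlgebra S) (a b : A) : Prop :=
  forall e : rel A, equivalence e ->
    (forall x y : A, ~ (forall z : A, Sg [set x; y] z) -> e x y) ->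
    e a b.

(* Main.v *)
Require Import Defs.
From mathcomp Require Import all_boot.
From mathcomp Require Import boolp.

Set Implicit Arguments.
Unset Strict Implicit.
Unset Printing Implicit Defensive.

(** Deleting redundant coordinates one at a time shows that a subdirect subpower
    of [A] contains every tuple all of whose binary projections it contains.
    Apply this to the subpower generated by the three columns of the rows
    (a,a,b), (a,b,a), (b,a,a), for all pairs with Sg(a,b) = A: it is subdirect
    since a and b generate [A], and any two rows share a column where both take
    their majority values, so the tuple of majority values belongs to it. *)

Lemma eval_power (S : signature) (A : finAlgebra S) (n m : nat)
    (v : {ffun 'I_m -> power A n}) (t : term S m) (i : 'I_n) :
  (eval v t : {ffun 'I_n -> A}) i =
  eval [ffun k => (v k : {ffun 'I_n -> A}) i] t.
Proof.
elim: t => [k|s args IH] /=; first by rewrite ffunE.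
rewrite ffunE; congr op; apply/ffunP => k.
by rewrite !ffunE IH.
Qed.

(** Used with [h := lift i], where it deletes coordinate [i]. *)
Lemma subpower_reindex (S : signature) (A : finAlgebra S) (m n : nat)
    (h : 'I_m -> 'I_n) (R : {set {ffun 'I_n -> A}}) :
  subpower R ->
  subpower [set [ffun k => r (h k)] | r : {ffun 'I_n -> A} in R].
Proof.
move=> subR s x xR.
have /fin_all_exists[y yP] (k : 'I_(arity s)) : exists y : {ffun 'I_n -> A},
    y \in R /\ x k = [ffun l => y (h l)].
  by have /imsetP[y yR ->] := xR k; exists y.
apply/imsetP; exists (@op S (power A n) s [ffun k => y k]).
  by apply: subR => k; rewrite ffunE; case: (yP k).
apply/ffunP => l; rewrite !ffunE; congr op; apply/ffunP => k.
by rewrite !ffunE; case: (yP k) => _ ->; rewrite ffunE.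
Qed.

Lemma subuniverse_proj (S : signature) (A : finAlgebra S) (n : nat)
    (R : {set {ffun 'I_n -> A}}) (i : 'I_n) :
  subpower R -> subuniverse [set r i | r : {ffun 'I_n -> A} in R].
Proof.
move=> subR s x xR.
have /fin_all_exists[y yP] (k : 'I_(arity s)) : exists y : {ffun 'I_n -> A},
    y \in R /\ x k = y i.
  by have /imsetP[y yR ->] := xR k; exists y.
apply/imsetP; exists (@op S (power A n) s [ffun k => y k]).
  by apply: subR => k; rewrite ffunE; case: (yP k).
rewrite ffunE; congr op; apply/ffunP => k.
by rewrite !ffunE; case: (yP k).
Qed.

(** Induction on [n]: a tuple [m] outside [R] makes [R] proper, so some coordinate [i] is a
    bijective copy of another coordinate [j] and can be deleted. Exponent 0 is the base case, where
    [R != set0] puts the only tuple into [R]; it also occurs below when no pair generates [A]. *)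
Lemma subdirect_2decomposable (S : signature) (A : finAlgebra S) (n : nat)
    (R : {set {ffun 'I_n -> A}}) (m : {ffun 'I_n -> A}) :
  no_subdirect_proper_irredundant_subpower A ->
  R != set0 -> subpower R -> subdirect R ->
  (forall i j, (m i, m j) \in proj2 R i j) -> m \in R.
Proof.
move=> hsub; elim: n => [|n IH] in R m *.
  case/set0Pn=> r rR _ _ _; suff -> : m = r by [].
  by apply/ffunP; case.
move=> R0 subR sdR mR2; apply/negPn/negP => mR; apply: hsub.
exists n.+1; split=> //; exists R; split=> //; first by move=> RT; rewrite RT inE in mR.
move=> i j ij [f bijf projE].
set R' := [set [ffun k => r (lift i k)] | r : {ffun 'I_n.+1 -> A} in R].
have : [ffun k => m (lift i k)] \in R'.
  apply: IH.
  - by case/set0Pn: R0 => r rR; apply/set0Pn; eexists; apply: imset_f rR.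
  - exact: subpower_reindex.
  - move=> k; apply/setP => a; rewrite inE.
    have : a \in [set: A] by [].
    rewrite -(sdR (lift i k)) => /imsetP[r rR ->]; apply/imsetP.
    by exists [ffun k => r (lift i k)]; rewrite ?imset_f ?ffunE.
  - move=> k l; rewrite !ffunE.
    have /imsetP[r rR [-> ->]] := mR2 (lift i k) (lift i l).
    by apply/imsetP; exists [ffun k => r (lift i k)]; rewrite ?imset_f ?ffunE.
case/imsetP=> r rR /ffunP rE; case/negP: mR; suff -> : m = r by [].
have rm k : k != i -> m k = r k.
  by rewrite eq_sym => /unlift_some[l -> _]; have := rE l; rewrite !ffunE.
have graphE (x y : A) : (x, y) \in proj2 R i j -> y = f x.
  by rewrite projE => /imsetP[z _ [-> ->]].
(* Off [i], and so at [j], the tuples [m] and [r] agree. Hence [f (m i) = m j = r j = f (r i)], and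
   injectivity of [f] settles coordinate [i]. *)
apply/ffunP => k; have [->|/rm//] := eqVneq k i.
apply: (bij_inj bijf); rewrite -(graphE _ _ (mR2 i j)) rm 1?eq_sym //.
by apply: graphE; apply/imsetP; exists r.
Qed.

(** Described by term values rather than as an intersection of subpowers, so that membership hands
    back a term. *)
Definition generated_power (S : signature) (A : finAlgebra S) (m n : nat)
    (g : {ffun 'I_m -> power A n}) : {set {ffun 'I_n -> A}} :=
  [set r | `[< exists t : term S m, r = eval g t >]].

Lemma generated_powerP (S : signature) (A : finAlgebra S) (m n : nat)
    (g : {ffun 'I_m -> power A n}) (r : {ffun 'I_n -> A}) :
  reflect (exists t : term S m, r = eval g t) (r \in generated_power g).
Proof. by rewrite inE; apply: asboolP. Qed.

Lemma mem_generated_power (S : signature) (A : finAlgebra S) (m n : nat)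
    (g : {ffun 'I_m -> power A n}) (k : 'I_m) :
  g k \in generated_power g.
Proof. by apply/generated_powerP; exists (Var S k). Qed.

Lemma subpower_generated (S : signature) (A : finAlgebra S) (m n : nat)
    (g : {ffun 'I_m -> power A n}) : subpower (generated_power g).
Proof.
move=> s x xR.
have /fin_all_exists[args argsE] (k : 'I_(arity s)) :
    exists t : term S m, x k = eval g t by apply/generated_powerP.
apply/generated_powerP; exists (App args).
have -> : x = [ffun k => eval g (args k)] by apply/ffunP => k; rewrite ffunE.
by [].
Qed.

Lemma Sg_of_not_mu (S : signature) (A : finAlgebra S) (a b : A) :
  ~ mu a b -> forall z : A, Sg [set a; b] z.
Proof.
by move=> nmu; apply: contrapT => nSg; apply: nmu => e _; apply.
Qed.

(** If [u] and [v] are the positions of the minority entries of two rows, column [k] shows the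
    majority entry in both. *)
Lemma third_index (u v : 'I_3) : exists k : 'I_3, (k != u) && (k != v).
Proof.
have : 0 < #|~: [set u; v]|.
  by rewrite cardsCs setCK card_ord cards2; case: (u == v).
by case/card_gt0P=> k; rewrite !inE negb_or => ?; exists k.
Qed.

Lemma majority_on_generating_pairs (S : signature) (A : finAlgebra S) :
  no_subdirect_proper_irredundant_subpower A ->
  exists t : term S 3, forall (a b : A) (u : 'I_3),
    (forall z, Sg [set a; b] z) ->
    eval [ffun k => if k == u then b else a] t = a.
Proof.
move=> hsub.
(* A triple [(a, b, u)] encodes the row with [b] in position [u] and [a] elsewhere; [g k] is the
   [k]-th column of the table of all such rows. *)
pose D : {set A * A * 'I_3} :=
  [set x | `[< forall z, Sg [set x.1.1; x.1.2] z >]].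
pose row (i : 'I_#|D|) := enum_val i.
pose g : {ffun 'I_3 -> power A #|D|} :=
  [ffun k => [ffun i => if k == (row i).2 then (row i).1.2 else (row i).1.1]].
have gE k i : (g k : {ffun 'I_#|D| -> A}) i =
    if k == (row i).2 then (row i).1.2 else (row i).1.1 by rewrite !ffunE.
have genR k := mem_generated_power g k.
have : [ffun i => (row i).1.1] \in generated_power g.
  apply: subdirect_2decomposable => //.
  - by apply/set0Pn; exists (g ord0).
  - exact: subpower_generated.
  - move=> i; apply/setP => z; rewrite inE.
    have : row i \in D := enum_valP i.
    rewrite inE => /asboolP/(_ z); apply.
      exact/subuniverse_proj/subpower_generated.
    (* The majority entry appears in any column other than [(row i).2], the minority entry in that
       column. *)
    apply/subsetP => c /set2P[]->; apply/imsetP.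
      have [k /andP[/negPf ki _]] := third_index (row i).2 (row i).2.
      by exists (g k); rewrite ?gE ?ki.
    by exists (g (row i).2); rewrite ?gE ?eqxx.
  - move=> i j.
    have [k /andP[/negPf ki /negPf kj]] := third_index (row i).2 (row j).2.
    by apply/imsetP; exists (g k); rewrite ?gE ?ki ?kj // !ffunE.
case/generated_powerP=> t /ffunP tE; exists t => a b u Sgab.
have Dabu : (a, b, u) \in D by rewrite inE; apply/asboolP.
(* Read [tE] at the coordinate of the row [(a, b, u)]. The selector [{2}] rewrites only the
   right-hand [a] and spares the one inside the row. *)
have := tE (enum_rank_in Dabu (a, b, u)).
rewrite eval_power ffunE /row enum_rankK_in //= => {2}->.
by congr eval; apply/ffunP => k; rewrite !ffunE /row enum_rankK_in.
Qed.

(** The default value of [nth] serves as the third entry, reached at index 2. *)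
Definition ffun3 (T : Type) (x y z : T) : {ffun 'I_3 -> T} :=
  [ffun k : 'I_3 => nth z [:: x; y] k].

Theorem mainTheorem5 (S : signature) (A : finAlgebra S)
    (hidem : idempotent_algebra A)
    (hsimple : simple_algebra A)
    (hsub : no_subdirect_proper_irredundant_subpower A) :
  exists2 t : A -> A -> A -> A, ternary_term_operation t &
    forall a b : A, ~ mu a b ->
      [/\ t a a b = a, t a b a = a & t b a a = a].
Proof.
have [t tP] := majority_on_generating_pairs hsub.
exists (fun x y z => eval (ffun3 x y z) t).
  exists t => v; congr eval; apply/ffunP => -[[|[|[|//]]] lt_k3]; rewrite ffunE /=;
    by apply: (congr1 v); apply: val_inj.
move=> a b /Sg_of_not_mu Sgab.
have majE (u : 'I_3) (v : {ffun 'I_3 -> A}) :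
    (forall k, v k = if k == u then b else a) -> eval v t = a.
  move=> vE; rewrite -[RHS](tP a b u Sgab); congr eval.
  by apply/ffunP => k; rewrite vE ffunE.
(* The ordinals 2, 1, 0 are the positions of [b] in the three identities. *)
split; [apply: (majE (@Ordinal 3 2 isT)) | apply: (majE (@Ordinal 3 1 isT))
      | apply: (majE (@Ordinal 3 0 isT))];
  by case=> [[|[|[|//]]] lt_k3]; rewrite ffunE.
Qed.
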